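(* Let $k\ge 3$, $n\ge k$, let $s_1,\dots,s_{k-1}$ be reals, and let $x\in S_k$. The following are equivalent: (1) $x$ is a local maximum of the function $y\mapsto\sum_{i=1}^n y_i^k$ on $S_k$; (2) there exist integers $1=i_1\le i_2\le\cdots\le i_k=n+1$ such that for each $j$, $x_{i_j}=x_{i_j+1}=\cdots=x_{i_{j+1}-1}$ (all coordinates with indices in $[i_j,i_{j+1})$ are equal), and $i_{2j}-i_{2j-1}\in\{0,1\}$ for each $j$ with $2j\le k$; (3) $x\succ_k y$ for all $y\in S_k$.
   Context: For integers $k\ge 3$, $n\ge k$ and reals $s_1,\dots,s_{k-1}$, $S_k:=\{(x_1,\dots,x_n)\in\mathbb{R}^n : x_1\ge x_2\ge\cdots\ge x_n,\ \sum_{i=1}^n x_i^j=s_j\text{ for }j=1,\dots,k-1\}$ with the subspace topology from $\mathbb{R}^n$. For $a,b\in\mathbb{R}^n$, $a\succ_k b$ means $\sum_{i=1}^n f(a_i)\ge\sum_{i=1}^n f(b_i)$ for every $k$ times differentiable $f:\mathbb{R}\to\mathbb{R}$ with $f^{(k)}\ge 0$. *)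

(* Defs.v *)
(* classical reals. Points of R^n are functions nat -> R,
   only the coordinates x 1, ..., x n (1-indexed, as in the paper) matter. *)
From Stdlib Require Import Reals Lra Lia.
Open Scope R_scope.

Fixpoint sumR (n : nat) (g : nat -> R) : R :=
  match n with
  | O => 0
  | S m => sumR m g + g (S m)
  end.

Definition psum (n j : nat) (x : nat -> R) : R := sumR n (fun i => x i ^ j).

Definition inS (k n : nat) (s : nat -> R) (x : nat -> R) : Prop :=
  (forall i, (1 <= i)%nat -> (i < n)%nat -> x (S i) <= x i) /\
  (forall j, (1 <= j)%nat -> (j <= k - 1)%nat -> psum n j x = s j).

Definition distn (n : nat) (x y : nat -> R) : R :=
  sqrt (sumR n (fun i => (y i - x i) ^ 2)).

Definition local_max_on_S (k n : nat) (s : nat -> R) (x : nat -> R) : Prop :=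
  exists eps, 0 < eps /\
    forall y, inS k n s y -> distn n x y < eps -> psum n k y <= psum n k x.

Definition k_convex (k : nat) (f : R -> R) : Prop :=
  exists F : nat -> R -> R,
    F O = f /\
    (forall m t, (m < k)%nat -> derivable_pt_lim (F m) t (F (S m) t)) /\
    (forall t, 0 <= F k t).

Definition majk (k n : nat) (a b : nat -> R) : Prop :=
  forall f : R -> R, k_convex k f ->
    sumR n (fun i => f (a i)) >= sumR n (fun i => f (b i)).

Definition block_cond (k n : nat) (x : nat -> R) : Prop :=
  exists ii : nat -> nat,
    ii 1%nat = 1%nat /\ ii k = S n /\
    (forall j, (1 <= j)%nat -> (j < k)%nat -> (ii j <= ii (S j))%nat) /\
    (forall j m, (1 <= j)%nat -> (j < k)%nat ->
        (ii j <= m)%nat -> (m < ii (S j))%nat -> x m = x (ii j)) /\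
    (forall j, (1 <= j)%nat -> (2 * j <= k)%nat ->
        ii (2 * j)%nat = ii (2 * j - 1)%nat \/ ii (2 * j)%nat = S (ii (2 * j - 1)%nat)).

(* Main.v *)
Require Import Defs.
From Stdlib Require Import Reals Lra Lia Compare_dec Arith.
Open Scope R_scope.

(* (2) => (3): along each constant block of x the differences d_i = x_i - y_i are nondecreasing,
   so the block condition allows (d_i) at most k-1 sign changes, counted from a virtual initial +.
   Hence there are k-1 distinct points t_1 > t_2 > ... such that prod_j (t - t_j) has the sign of
   d_i between x_i and y_i.  If p interpolates f' at the t_j, then f' - p has the same sign pattern
   because f^(k) >= 0, so with P' = p one gets (f - P)(x_i) >= (f - P)(y_i) for every single i;
   summing over i, P drops out since deg P < k.
   (3) => (1): take f(t) = t^k.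
   (1) => (2): build the blocks greedily.  If they do not exhaust the coordinates, one finds k
   coordinates u_1 >= u_2 > u_3 >= u_4 > ... of x that can be moved alternately up and down.
   Replacing them by the roots of prod_j (t - u_j) = e for a small e > 0 preserves the power
   sums of order < k and raises the one of order k by k e, by Newton's identities. *)

(** * Finite sums, finite choice and positive lower bounds *)

Lemma sumR_S m f : sumR (S m) f = sumR m f + f (S m).
Proof. reflexivity. Qed.

Lemma sumR_ext m f g :
  (forall i, (1 <= i <= m)%nat -> f i = g i) -> sumR m f = sumR m g.
Proof.
induction m as [|m IH]; intros H; simpl; [reflexivity|].
rewrite IH, (H (S m)); [reflexivity|lia|intros; apply H; lia].
Qed.

Lemma sumR_le m f g :
  (forall i, (1 <= i <= m)%nat -> f i <= g i) -> sumR m f <= sumR m g.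
Proof.
induction m as [|m IH]; intros H; simpl; [lra|].
apply Rplus_le_compat; [apply IH; intros; apply H|apply H]; lia.
Qed.

Lemma sumR_plus m f g : sumR m (fun i => f i + g i) = sumR m f + sumR m g.
Proof. induction m as [|m IH]; simpl; [|rewrite IH]; ring. Qed.

Lemma sumR_scal m a f : sumR m (fun i => a * f i) = a * sumR m f.
Proof. induction m as [|m IH]; simpl; [|rewrite IH]; ring. Qed.

Lemma sumR_const m a : sumR m (fun _ => a) = INR m * a.
Proof. induction m as [|m IH]; [simpl; ring|]. rewrite S_INR; simpl; rewrite IH; ring. Qed.

Lemma sumR_shift m f : sumR (S m) f = f 1%nat + sumR m (fun i => f (S i)).
Proof. induction m as [|m IH]; simpl; [ring|]. simpl in IH; rewrite IH; ring. Qed.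

Lemma finite_choice (P : nat -> R -> Prop) m :
  (forall i, (1 <= i <= m)%nat -> exists r, P i r) ->
  exists g, forall i, (1 <= i <= m)%nat -> P i (g i).
Proof.
induction m as [|m IH]; intros H.
- exists (fun _ => 0); intros; lia.
- destruct IH as [g Hg]; [intros; apply H; lia|].
  destruct (H (S m)) as [r Hr]; [lia|].
  exists (fun i => if Nat.eq_dec i (S m) then r else g i); intros i Hi.
  destruct (Nat.eq_dec i (S m)) as [->|]; [assumption|apply Hg; lia].
Qed.

Lemma finite_pos_lower_bound (v : nat -> R) m :
  (forall i, (1 <= i <= m)%nat -> 0 < v i) ->
  exists e, 0 < e /\ forall i, (1 <= i <= m)%nat -> e < v i.
Proof.
induction m as [|m IH]; intros H.
- exists 1; split; [lra|intros; lia].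
- destruct IH as [e [He Hm]]; [intros; apply H; lia|].
  assert (Hv : 0 < v (S m)) by (apply H; lia).
  exists (Rmin e (v (S m) / 2)); split.
  + apply Rmin_glb_lt; lra.
  + intros i Hi; destruct (Nat.eq_dec i (S m)) as [->|].
    * eapply Rle_lt_trans; [apply Rmin_r|lra].
    * eapply Rle_lt_trans; [apply Rmin_l|apply Hm; lia].
Qed.

(** * Polynomials given by their coefficients *)

(** Here [m] is the number of coefficients, so the degree is less than [m]. With [m = k] these are
    exactly the polynomials whose sums over a point are fixed on S_k. *)
Fixpoint peval (m : nat) (c : nat -> R) (t : R) : R :=
  match m with
  | O => 0
  | S m' => peval m' c t + c m' * t ^ m'
  end.

Definition dcoef (c : nat -> R) (j : nat) : R := INR (S j) * c (S j).

Lemma peval_S m c t : peval (S m) c t = peval m c t + c m * t ^ m.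
Proof. reflexivity. Qed.

Lemma peval_ext m c d t :
  (forall j, (j < m)%nat -> c j = d j) -> peval m c t = peval m d t.
Proof.
induction m as [|m IH]; intros H; simpl; [reflexivity|].
rewrite IH, (H m); [reflexivity|lia|intros; apply H; lia].
Qed.

Lemma peval_lin m a b c d t :
  peval m (fun j => a * c j + b * d j) t = a * peval m c t + b * peval m d t.
Proof. induction m as [|m IH]; simpl; [|rewrite IH]; ring. Qed.

Lemma peval_0 m t : peval m (fun _ => 0) t = 0.
Proof. induction m as [|m IH]; simpl; [|rewrite IH]; ring. Qed.

Lemma peval_shift m c t :
  peval (S m) c t = c O + t * peval m (fun j => c (S j)) t.
Proof. induction m as [|m IH]; simpl; [ring|]. simpl in IH; rewrite IH; ring. Qed.

Lemma peval_deriv m c t :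
  derivable_pt_lim (peval (S m) c) t (peval m (dcoef c) t).
Proof.
induction m as [|m IH].
- simpl. apply (derivable_pt_lim_ext (fun _ => c O)); [intros; ring|].
  apply derivable_pt_lim_const.
- change (derivable_pt_lim (peval (S m) c + mult_real_fct (c (S m)) (fun s => s ^ S m))%F t
    (peval m (dcoef c) t + dcoef c m * t ^ m)).
  apply derivable_pt_lim_plus; [exact IH|].
  replace (dcoef c m * t ^ m) with (c (S m) * (INR (S m) * t ^ pred (S m)))
    by (unfold dcoef; simpl pred; ring).
  apply derivable_pt_lim_scal, derivable_pt_lim_pow.
Qed.

Lemma peval_continuity m c : continuity (peval m c).
Proof.
destruct m as [|m].
- apply continuity_const; intros ? ?; reflexivity.
- apply derivable_continuous; intro t.
  exists (peval m (dcoef c) t); apply peval_deriv.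
Qed.

(** The factor is (i+j)!/j!; later arguments only use its sign. *)
Lemma iter_dcoef i j : exists a, 0 < a /\
  forall c, Nat.iter i dcoef c j = a * c (i + j)%nat.
Proof.
revert j; induction i as [|i IH]; intros j.
- exists 1; split; [lra|intros; simpl; ring].
- destruct (IH (S j)) as [a [Ha Hc]].
  exists (INR (S j) * a); split.
  + apply Rmult_lt_0_compat; [apply lt_0_INR; lia|assumption].
  + intros c; simpl Nat.iter; unfold dcoef at 1; rewrite Hc.
    rewrite Nat.add_succ_r; simpl plus; ring.
Qed.

(** Evaluating at 1 turns [peval] into a plain sum over the orders 0, ..., m-1, so the polynomial
    part depends on [x] only through its power sums. *)
Lemma sumR_peval n m c x :
  sumR n (fun i => peval m c (x i)) = peval m (fun j => c j * psum n j x) 1.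
Proof.
induction m as [|m IH]; simpl.
- rewrite sumR_const; ring.
- rewrite sumR_plus, IH, sumR_scal, pow1; unfold psum; ring.
Qed.

(** * Rolle's theorem for repeated derivatives *)

Definition tower (m : nat) (F : nat -> R -> R) : Prop :=
  forall j t, (j < m)%nat -> derivable_pt_lim (F j) t (F (S j) t).

Definition decr (m : nat) (z : nat -> R) : Prop :=
  forall i, (1 <= i)%nat -> (i < m)%nat -> z (S i) < z i.

Lemma decr_lt m z i j : decr m z -> (1 <= i)%nat -> (i < j)%nat -> (j <= m)%nat -> z j < z i.
Proof.
intros Hz Hi Hij; induction Hij as [|j Hij IH]; intros Hj.
- apply Hz; lia.
- apply Rlt_trans with (z j); [apply Hz; lia|apply IH; lia].
Qed.

Lemma tower_peval m c : tower m (fun i => peval (m - i) (Nat.iter i dcoef c)).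
Proof.
intros j t Hj; cbv beta.
replace (m - j)%nat with (S (m - S j)) by lia.
apply peval_deriv.
Qed.

Lemma rolle_decr (f f' : R -> R) m z :
  (forall t, derivable_pt_lim f t (f' t)) -> decr (S m) z ->
  (forall i, (1 <= i <= S m)%nat -> f (z i) = 0) ->
  exists z', decr m z' /\ forall i, (1 <= i <= m)%nat -> f' (z' i) = 0.
Proof.
intros Hf Hz H0.
destruct (finite_choice (fun i r => z (S i) < r < z i /\ f' r = 0) m) as [z' Hz'].
- intros i Hi.
  assert (Hlt : z (S i) < z i) by (apply Hz; lia).
  destruct (MVT_cor2 f f' _ _ Hlt) as [r [Hr Hin]]; [intros; apply Hf|].
  exists r; split; [assumption|].
  rewrite !H0 in Hr by lia.
  apply Rmult_eq_reg_r with (z i - z (S i)); lra.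
- exists z'; split.
  + intros i Hi Him.
    destruct (Hz' i) as [[? ?] _]; [lia|]; destruct (Hz' (S i)) as [[? ?] _]; [lia|lra].
  + intros i Hi; apply Hz'; assumption.
Qed.

Lemma rolle_tower m F z :
  tower m F -> decr (S m) z ->
  (forall i, (1 <= i <= S m)%nat -> F O (z i) = 0) -> exists xi, F m xi = 0.
Proof.
revert F z; induction m as [|m IH]; intros F z HF Hz H0.
- exists (z 1%nat); apply H0; lia.
- destruct (rolle_decr (F O) (F 1%nat) (S m) z) as [z' [Hz' H0']];
    [intros; apply HF; lia|assumption|assumption|].
  apply (IH (fun j => F (S j)) z'); [intros j t Hj; apply HF; lia|assumption|assumption].
Qed.

(** By Rolle the derivative has one zero fewer, so induction kills every coefficient but the
    constant one, and any single zero kills that. *)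
Lemma peval_zeros_coef m c z :
  decr m z -> (forall i, (1 <= i <= m)%nat -> peval m c (z i) = 0) ->
  forall j, (j < m)%nat -> c j = 0.
Proof.
revert c z; induction m as [|m IH]; intros c z Hz H0 j Hj; [lia|].
destruct (rolle_decr (peval (S m) c) (peval m (dcoef c)) m z) as [z' [Hz' H0']];
  [intros; apply peval_deriv|assumption|assumption|].
assert (Hc : forall i, (i < m)%nat -> c (S i) = 0).
{ intros i Hi. assert (Hd := IH _ _ Hz' H0' i Hi); unfold dcoef in Hd.
  apply Rmult_integral in Hd; destruct Hd as [Hd|]; [|assumption].
  apply INR_eq in Hd; [lia] || (assert (0 < INR (S i)) by (apply lt_0_INR; lia); lra). }
destruct j as [|j]; [|apply Hc; lia].
assert (H1 : peval (S m) c (z 1%nat) = 0) by (apply H0; lia).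
rewrite peval_shift, (peval_ext m _ (fun _ => 0)), peval_0 in H1 by exact Hc.
lra.
Qed.

(** * Monic polynomials with given roots *)

Fixpoint prodR (m : nat) (g : nat -> R) : R :=
  match m with
  | O => 1
  | S m' => prodR m' g * g (S m')
  end.

Definition rootpoly (m : nat) (u : nat -> R) (t : R) : R := prodR m (fun i => t - u i).

(* Signed elementary symmetric functions: rootpoly m u t = sum_j esym m u j * t^(m-j). *)
Fixpoint esym (m : nat) (u : nat -> R) (j : nat) : R :=
  match j with
  | O => 1
  | S j' => match m with
            | O => 0
            | S m' => esym m' u (S j') - u (S m') * esym m' u j'
            end
  end.

Lemma esym_0 m u : esym m u 0 = 1.
Proof. destruct m; reflexivity. Qed.

Lemma esym_big m u j : (m < j)%nat -> esym m u j = 0.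
Proof.
revert j; induction m as [|m IH]; intros [|j] Hj; simpl; try lia; [reflexivity|].
rewrite !IH by lia; ring.
Qed.

Lemma rootpoly_peval m u t :
  rootpoly m u t = peval (S m) (fun j => esym m u (m - j)) t.
Proof.
induction m as [|m IH]; [simpl; unfold rootpoly; simpl; ring|].
change (rootpoly (S m) u t) with (rootpoly m u t * (t - u (S m))).
transitivity (t * rootpoly m u t - u (S m) * rootpoly m u t); [ring|].
rewrite IH at 1.
assert (Hs := peval_shift (S m) (fun j => esym m u (S m - j)) t).
cbv beta in Hs; rewrite Nat.sub_0_r, esym_big in Hs by lia.
replace (t * peval (S m) (fun j => esym m u (m - j)) t)
  with (peval (S (S m)) (fun j => esym m u (S m - j)) t) by (rewrite Hs; simpl minus; ring).
rewrite IH.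
rewrite !(peval_S (S m)).
rewrite Nat.sub_diag, !esym_0.
rewrite (peval_ext (S m) (fun j => esym (S m) u (S m - j))
  (fun j => 1 * esym m u (S m - j) + (- u (S m)) * esym m u (m - j))), peval_lin; [ring|].
intros j Hj; replace (S m - j)%nat with (S (m - j)) by lia; simpl; ring.
Qed.

Lemma rootpoly_root m u i : (1 <= i <= m)%nat -> rootpoly m u (u i) = 0.
Proof.
unfold rootpoly; intros Hi.
enough (H : forall p, (i <= p)%nat -> prodR p (fun j => u i - u j) = 0) by (apply H; lia).
intros p Hp; induction Hp as [|p Hp IH].
- destruct i as [|i]; [lia|]; simpl; ring.
- simpl; rewrite IH; ring.
Qed.

Lemma rootpoly_sign m u t q :
  (q <= m)%nat -> (forall i, (1 <= i <= q)%nat -> t < u i) ->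
  (forall i, (q < i <= m)%nat -> u i < t) -> 0 < (-1) ^ q * rootpoly m u t.
Proof.
revert q; induction m as [|m IH]; intros q Hq Hlo Hhi.
- replace q with O by lia; unfold rootpoly; simpl; lra.
- change (rootpoly (S m) u t) with (rootpoly m u t * (t - u (S m))).
  destruct (Nat.eq_dec q (S m)) as [->|Hne].
  + assert (H1 : t < u (S m)) by (apply Hlo; lia).
    assert (H2 : 0 < (-1) ^ m * rootpoly m u t)
      by (apply IH; [lia|intros; apply Hlo; lia|intros; lia]).
    replace ((-1) ^ S m * (rootpoly m u t * (t - u (S m))))
      with ((-1) ^ m * rootpoly m u t * (u (S m) - t)) by (simpl; ring).
    apply Rmult_lt_0_compat; lra.
  + assert (H1 : u (S m) < t) by (apply Hhi; lia).
    assert (H2 : 0 < (-1) ^ q * rootpoly m u t)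
      by (apply IH; [lia|assumption|intros; apply Hhi; lia]).
    rewrite <- Rmult_assoc; apply Rmult_lt_0_compat; lra.
Qed.

Lemma rootpoly_neq0 m u t :
  (forall i, (1 <= i <= m)%nat -> t <> u i) -> rootpoly m u t <> 0.
Proof.
unfold rootpoly; induction m as [|m IH]; intros H; simpl; [lra|].
apply Rmult_integral_contrapositive; split.
- apply IH; intros; apply H; lia.
- assert (t <> u (S m)) by (apply H; lia); lra.
Qed.

(** * Newton's identities *)

(** This is the recursion of [esym] summed over [i]. The term [i = S j] has [esym] of order 0, equal
    to 1 on both sides, so the correction stops at [j]. *)
Lemma newton_step (p : nat -> R) m u j :
  sumR (S j) (fun i => p i * esym (S m) u (S j - i)) =
  sumR (S j) (fun i => p i * esym m u (S j - i))
    - u (S m) * sumR j (fun i => p i * esym m u (j - i)).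
Proof.
rewrite !(sumR_S j), Nat.sub_diag, !esym_0, <- sumR_scal.
rewrite (sumR_ext j (fun i => p i * esym (S m) u (S j - i))
  (fun i => p i * esym m u (S j - i) + (-1) * (u (S m) * (p i * esym m u (j - i))))).
- rewrite sumR_plus, (sumR_scal j (-1)); ring.
- intros i Hi; replace (S j - i)%nat with (S (j - i)) by lia; simpl; ring.
Qed.

(** Induction on the number of variables, for all orders [j] at once: [esym] vanishes beyond [m], so
    [j > m] needs no separate treatment. *)
Lemma newton m u j :
  sumR j (fun i => psum m i u * esym m u (j - i)) + INR j * esym m u j = 0.
Proof.
revert j; induction m as [|m IH]; intros j.
- rewrite (sumR_ext j _ (fun _ => 0)) by (intros; unfold psum; simpl; ring).
  rewrite sumR_const; destruct j; simpl; ring.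
- destruct j as [|j]; [simpl; ring|].
  rewrite (sumR_ext (S j) _ (fun i => psum m i u * esym (S m) u (S j - i)
     + u (S m) ^ i * esym (S m) u (S j - i))) by (intros; unfold psum; simpl; ring).
  rewrite sumR_plus, !newton_step.
  (* The sum of the powers of the new variable telescopes against its own correction and leaves
     [u (S m) * esym m u j]. *)
  rewrite (sumR_shift j (fun i => u (S m) ^ i * _)).
  rewrite (sumR_ext j (fun i => u (S m) ^ S i * esym m u (S j - S i))
    (fun i => u (S m) * (u (S m) ^ i * esym m u (j - i)))) by (intros; simpl; ring).
  rewrite sumR_scal.
  assert (H1 := IH (S j)); assert (H2 := IH j).
  rewrite S_INR in *.
  replace (S j - 1)%nat with j by lia.
  change (esym (S m) u (S j)) with (esym m u (S j) - u (S m) * esym m u j).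
  set (A := sumR (S j) _) in *; set (B := sumR j _) in *.
  replace A with (- ((INR j + 1) * esym m u (S j))) by lra.
  replace B with (- (INR j * esym m u j)) by lra.
  ring.
Qed.

(** Newton's identity of order j determines the power sum of order j from the lower ones and [esym]
    up to order j. The first discrepancy thus appears at order [k], where [esym] enters with the
    factor [INR k]. *)
Lemma newton_perturb k u w e :
  (1 <= k)%nat -> (forall j, (j < k)%nat -> esym k w j = esym k u j) ->
  esym k w k = esym k u k - e ->
  (forall j, (1 <= j)%nat -> (j < k)%nat -> psum k j w = psum k j u) /\
  psum k k w = psum k k u + INR k * e.
Proof.
intros Hk He Hek.
assert (Hstep : forall j, (j < k)%nat ->
  (forall i, (1 <= i <= j)%nat -> psum k i w = psum k i u) ->
  psum k (S j) w + INR (S j) * esym k w (S j) = psum k (S j) u + INR (S j) * esym k u (S j)).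
{ intros j Hj Hp.
  assert (Hu := newton k u (S j)); assert (Hw := newton k w (S j)).
  rewrite sumR_S in Hu, Hw; rewrite Nat.sub_diag, esym_0 in Hu, Hw.
  rewrite (sumR_ext j _ (fun i => psum k i u * esym k u (S j - i))) in Hw; [lra|].
  intros i Hi; rewrite Hp, He by lia; reflexivity. }
assert (Hlt : forall j, (j < k)%nat ->
  forall i, (1 <= i <= j)%nat -> psum k i w = psum k i u).
{ induction j as [|j IH]; intros Hj i Hi; [lia|].
  destruct (Nat.eq_dec i (S j)) as [->|]; [|apply IH; lia].
  assert (H := Hstep j ltac:(lia) ltac:(intros; apply IH; lia)).
  rewrite He in H by lia; lra. }
split; [intros j H1 H2; apply (Hlt j); lia|].
destruct k as [|k]; [lia|].
assert (H := Hstep k ltac:(lia) (Hlt k ltac:(lia))).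
rewrite Hek in H; lra.
Qed.

(** The polynomial [rootpoly k u - e - rootpoly k w] has degree below [k], since the leading terms
    cancel, and vanishes at the [k] distinct points [w i]; hence all its coefficients are 0. *)
Lemma esym_of_shifted_rootpoly k u w e :
  (1 <= k)%nat -> decr k w ->
  (forall i, (1 <= i <= k)%nat -> rootpoly k u (w i) = e) ->
  (forall j, (j < k)%nat -> esym k w j = esym k u j) /\ esym k w k = esym k u k - e.
Proof.
intros Hk Hw Hr.
(* The factors 1 and -1 shape the coefficients for [peval_lin]; the match encodes the constant
   polynomial 1. *)
assert (H : forall j, (j < k)%nat ->
  1 * esym k u (k - j) + (-1) * (1 * esym k w (k - j) + e * match j with O => 1 | _ => 0 end) = 0).
{ apply (peval_zeros_coef k (fun j => _) w Hw).
  intros i Hi.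
  rewrite (peval_lin k 1 (-1)), peval_lin.
  assert (Hu := rootpoly_peval k u (w i)); rewrite Hr in Hu by assumption.
  assert (Hw' := rootpoly_peval k w (w i)); rewrite rootpoly_root in Hw' by assumption.
  rewrite peval_S in Hu, Hw'; rewrite Nat.sub_diag, esym_0 in Hu, Hw'.
  assert (H1 : peval k (fun j => match j with O => 1 | _ => 0 end) (w i) = 1).
  { destruct k as [|k]; [lia|]; rewrite peval_shift, peval_0; ring. }
  rewrite H1; lra. }
split.
- intros j Hj; destruct j as [|j]; [now rewrite !esym_0|].
  assert (H1 := H (k - S j)%nat ltac:(lia)).
  replace (k - (k - S j))%nat with (S j) in H1 by lia.
  destruct (k - S j)%nat eqn:E; [lia|lra].
- assert (H1 := H O ltac:(lia)); rewrite Nat.sub_0_r in H1; lra.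
Qed.

(** * Interpolation *)

(** Prepares Rolle's theorem, which wants the nodes and the evaluation point in one sorted list. In
    the proof [q] counts the nodes above [t]. *)
Lemma decr_insert m z t :
  decr m z -> (forall i, (1 <= i <= m)%nat -> t <> z i) ->
  exists z', decr (S m) z' /\
    forall i, (1 <= i <= S m)%nat -> z' i = t \/ exists i', (1 <= i' <= m)%nat /\ z' i = z i'.
Proof.
intros Hz Ht.
assert (Hq : exists q, (q <= m)%nat /\ (forall i, (1 <= i <= q)%nat -> t < z i) /\
  (forall i, (q < i <= m)%nat -> z i < t)).
{ clear -Hz Ht; induction m as [|m IH].
  - exists O; repeat split; intros; lia.
  - destruct (Rlt_dec t (z (S m))) as [Hlt|Hge].
    + exists (S m); repeat split; [lia| |intros; lia].
      intros i Hi; destruct (Nat.eq_dec i (S m)) as [->|]; [assumption|].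
      apply Rlt_trans with (z (S m)); [assumption|apply (decr_lt (S m)); [assumption|lia..]].
    + destruct IH as [q [Hq [Hlo Hhi]]];
        [intros i ? ?; apply Hz; lia|intros; apply Ht; lia|].
      exists q; repeat split; [lia|assumption|].
      intros i Hi; destruct (Nat.eq_dec i (S m)) as [->|]; [|apply Hhi; lia].
      assert (t <> z (S m)) by (apply Ht; lia); lra. }
destruct Hq as [q [Hq [Hlo Hhi]]].
exists (fun i => if le_lt_dec i q then z i else
  if Nat.eq_dec i (S q) then t else z (pred i)); split.
- intros i Hi Him.
  destruct (le_lt_dec (S i) q), (le_lt_dec i q); try lia.
  + apply Hz; lia.
  + destruct (Nat.eq_dec (S i) (S q)); [apply Hlo; lia|lia].
  + destruct (Nat.eq_dec (S i) (S q)); [lia|].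
    destruct (Nat.eq_dec i (S q)); [apply Hhi; lia|].
    change (z i < z (pred i)); replace i with (S (pred i)) at 1 by lia; apply Hz; lia.
- intros i Hi.
  destruct (le_lt_dec i q); [right; exists i; split; [lia|reflexivity]|].
  destruct (Nat.eq_dec i (S q)); [now left|].
  right; exists (pred i); split; [lia|reflexivity].
Qed.

Lemma decr_neq m z i j : decr m z -> (1 <= i <= m)%nat -> (1 <= j <= m)%nat -> i <> j -> z i <> z j.
Proof.
intros Hz Hi Hj Hij; destruct (Nat.lt_gt_cases i j) as [H _]; destruct (H Hij).
- assert (z j < z i) by (apply (decr_lt m); [assumption|lia..]); lra.
- assert (z i < z j) by (apply (decr_lt m); [assumption|lia..]); lra.
Qed.

(** Newton's form: adding a multiple of [rootpoly m z] keeps the values at the old nodes. The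
    multiple fitting [t] is a divided difference and becomes the leading coefficient [c' m]. *)
Lemma newton_form_extend m c z (f : R -> R) t :
  (forall i, (1 <= i <= m)%nat -> t <> z i) ->
  (forall i, (1 <= i <= m)%nat -> f (z i) = peval m c (z i)) ->
  exists c', f t - peval m c t = c' m * rootpoly m z t /\ f t = peval (S m) c' t /\
    forall i, (1 <= i <= m)%nat -> f (z i) = peval (S m) c' (z i).
Proof.
intros Ht Hf.
assert (Hn := rootpoly_neq0 m z t Ht).
set (a := (f t - peval m c t) / rootpoly m z t).
set (c' := fun j => (if Nat.eq_dec j m then 0 else c j) + a * esym m z (m - j)).
assert (Hc : forall s, peval (S m) c' s = peval m c s + a * rootpoly m z s).
{ intros s; rewrite rootpoly_peval.
  rewrite (peval_ext _ c' (fun j => 1 * (if Nat.eq_dec j m then 0 else c j)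
     + a * esym m z (m - j))), peval_lin by (intros; unfold c'; ring).
  simpl peval at 1; destruct (Nat.eq_dec m m); [|lia].
  rewrite (peval_ext m _ c); [ring|].
  intros j Hj; destruct (Nat.eq_dec j m); [lia|reflexivity]. }
exists c'; split; [|split].
- unfold c'; destruct (Nat.eq_dec m m); [|lia].
  rewrite Nat.sub_diag, esym_0; unfold a; field; assumption.
- rewrite Hc; unfold a; field; assumption.
- intros i Hi; rewrite Hc, rootpoly_root, Hf by assumption; ring.
Qed.

Lemma interpolation m z f :
  decr m z -> exists c, forall i, (1 <= i <= m)%nat -> f (z i) = peval m c (z i).
Proof.
induction m as [|m IH]; intros Hz.
- exists (fun _ => 0); intros; lia.
- destruct IH as [c Hc]; [intros i ? ?; apply Hz; lia|].
  destruct (newton_form_extend m c z f (z (S m))) as [c' [_ [H1 H2]]].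
  + intros i Hi; apply (decr_neq (S m)); [assumption|lia..].
  + assumption.
  + exists c'; intros i Hi; destruct (Nat.eq_dec i (S m)) as [->|]; [assumption|apply H2; lia].
Qed.

(** Off the nodes the error at [t] is [c' m * rootpoly m z t], with [c'] interpolating at [t] as
    well. Rolle on these m+1 zeros equates [F m xi] with a positive multiple of [c' m], so
    [c' m >= 0] and the product is [c' m] times a square. *)
Lemma interpolation_error_sign m z F :
  tower m F -> (forall t, 0 <= F m t) -> decr m z ->
  exists c, forall t, 0 <= (F O t - peval m c t) * rootpoly m z t.
Proof.
intros HF Hpos Hz.
destruct (interpolation m z (F O) Hz) as [c Hc].
exists c; intros t.
destruct (Req_dec (rootpoly m z t) 0) as [->|Hn]; [lra|].
assert (Ht : forall i, (1 <= i <= m)%nat -> t <> z i).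
{ intros i Hi ->; apply Hn, rootpoly_root; assumption. }
destruct (newton_form_extend m c z (F O) t Ht Hc) as [c' [Hl [H1 H2]]].
destruct (decr_insert m z t Hz Ht) as [z' [Hz' Hin]].
destruct (rolle_tower m (fun j s => F j s - peval (S m - j) (Nat.iter j dcoef c') s) z')
  as [xi Hxi].
- intros j s Hj.
  apply (derivable_pt_lim_minus (F j)); [apply HF; lia|].
  apply (tower_peval (S m) c'); lia.
- assumption.
- intros i Hi; simpl Nat.iter; rewrite Nat.sub_0_r.
  destruct (Hin i Hi) as [->|[i' [Hi' ->]]]; [rewrite H1; ring|rewrite (H2 i' Hi'); ring].
- cbv beta in Hxi; replace (S m - m)%nat with 1%nat in Hxi by lia.
  simpl peval in Hxi.
  destruct (iter_dcoef m 0) as [a [Ha Hca]]; rewrite Hca, Nat.add_0_r in Hxi.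
  assert (Hc0 : 0 <= c' m).
  { specialize (Hpos xi); apply Rmult_le_reg_l with a; lra. }
  rewrite Hl.
  replace (c' m * rootpoly m z t * rootpoly m z t) with (c' m * (rootpoly m z t)²)
    by (unfold Rsqr; ring).
  apply Rmult_le_pos; [assumption|apply Rle_0_sqr].
Qed.

(** * Sign changes of x - y *)

Definition noninc (n : nat) (x : nat -> R) : Prop :=
  forall i, (1 <= i)%nat -> (i < n)%nat -> x (S i) <= x i.

Lemma noninc_le n x i j :
  noninc n x -> (1 <= i)%nat -> (i <= j)%nat -> (j <= n)%nat -> x j <= x i.
Proof.
intros Hx Hi Hij; induction Hij as [|j Hij IH]; intros Hj; [lra|].
apply Rle_trans with (x j); [apply Hx; lia|apply IH; lia].
Qed.

Definition between (a b t : R) : Prop := (a < t /\ t < b) \/ (b < t /\ t < a).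

(** The intervals are open because the mean value theorem yields interior points; nodes may
    therefore sit at [x i] or [y i]. *)
Definition separates (N len : nat) (tau x y : nat -> R) : Prop :=
  decr len tau /\
  forall i t, (1 <= i <= N)%nat -> between (x i) (y i) t ->
    0 < (x i - y i) * rootpoly len tau t.

(* tau lists the points where the sign of x_i - y_i flips as i runs up to N, starting from a
   virtual + sign; the parity of len thus encodes the last sign met. *)
Definition sign_changes (N len : nat) (tau x y : nat -> R) : Prop :=
  separates N len tau x y /\
  (forall r, (1 <= r <= len)%nat -> exists i0, (1 <= i0 <= N)%nat /\
     0 < (-1) ^ len * (x i0 - y i0) /\ Rmax (x i0) (y i0) <= tau r) /\
  (forall i, (1 <= i <= N)%nat -> (-1) ^ len * (x i - y i) < 0 ->
     exists i0, (i < i0 <= N)%nat /\ 0 < (-1) ^ len * (x i0 - y i0)).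

Definition snoc (tau : nat -> R) (len : nat) (r : R) : nat -> R :=
  fun i => if Nat.eq_dec i (S len) then r else tau i.

Lemma snoc_last tau len r : snoc tau len r (S len) = r.
Proof. unfold snoc; destruct (Nat.eq_dec (S len) (S len)); [reflexivity|lia]. Qed.

Lemma snoc_init tau len r i : (i <= len)%nat -> snoc tau len r i = tau i.
Proof. intros H; unfold snoc; destruct (Nat.eq_dec i (S len)); [lia|reflexivity]. Qed.

Lemma decr_snoc tau len r :
  decr len tau -> (forall i, (1 <= i <= len)%nat -> r < tau i) -> decr (S len) (snoc tau len r).
Proof.
intros H Hr i Hi Hlt; rewrite (snoc_init _ _ _ i) by lia.
destruct (Nat.eq_dec i len) as [->|]; [rewrite snoc_last; apply Hr; lia|].
rewrite snoc_init by lia; apply H; lia.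
Qed.

Lemma rootpoly_snoc tau len r t :
  rootpoly (S len) (snoc tau len r) t = rootpoly len tau t * (t - r).
Proof.
unfold rootpoly; simpl prodR; rewrite snoc_last; f_equal.
enough (H : forall m, (m <= len)%nat ->
  prodR m (fun i => t - snoc tau len r i) = prodR m (fun i => t - tau i)) by (apply H; lia).
induction m as [|m IH]; intros Hm; simpl; [reflexivity|].
rewrite IH, snoc_init by lia; reflexivity.
Qed.

Lemma pow_m1_cases m : (-1) ^ m = 1 \/ (-1) ^ m = -1.
Proof. induction m as [|m [IH|IH]]; simpl; [left; ring|rewrite IH; right; ring|rewrite IH; left; ring]. Qed.

Lemma pow_m1_even m : Nat.Even m -> (-1) ^ m = 1.
Proof. intros [j ->]; apply pow_1_even. Qed.

Lemma rootpoly_sign_below m tau d t :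
  (forall r, (1 <= r <= m)%nat -> t < tau r) -> 0 < (-1) ^ m * d ->
  0 < d * rootpoly m tau t.
Proof.
intros Ht Hd.
assert (H : 0 < (-1) ^ m * rootpoly m tau t)
  by (apply rootpoly_sign; [lia|assumption|intros; lia]).
assert (H' := Rmult_lt_0_compat _ _ Hd H).
destruct (pow_m1_cases m) as [E|E]; rewrite E in H'; lra.
Qed.

Lemma between_lt_max a b t : between a b t -> t < Rmax a b.
Proof.
intros [[_ H]|[_ H]]; (eapply Rlt_le_trans; [exact H|]); [apply Rmax_r|apply Rmax_l].
Qed.

Lemma between_neq a b t : between a b t -> a - b <> 0.
Proof. intros [[? ?]|[? ?]]; lra. Qed.

Lemma Rmax_noninc n x y i j :
  noninc n x -> noninc n y -> (1 <= i)%nat -> (i <= j)%nat -> (j <= n)%nat ->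
  Rmax (x j) (y j) <= Rmax (x i) (y i).
Proof.
intros Hx Hy Hi Hij Hj.
assert (x j <= x i) by (eapply noninc_le; eassumption).
assert (y j <= y i) by (eapply noninc_le; eassumption).
apply Rmax_lub; [eapply Rle_trans; [|apply Rmax_l]|eapply Rle_trans; [|apply Rmax_r]]; assumption.
Qed.

(** By monotonicity the interval of the new coordinate lies below all nodes, where [rootpoly] has
    the sign [(-1) ^ len]. *)
Lemma sign_changes_keep n N len tau x y :
  noninc n x -> noninc n y -> (S N <= n)%nat -> sign_changes N len tau x y ->
  0 <= (-1) ^ len * (x (S N) - y (S N)) -> sign_changes (S N) len tau x y.
Proof.
intros Hx Hy HN [[Hd HS] [HR HM]] Hs.
split; [split; [assumption|]|split].
- intros i t Hi Ht; destruct (Nat.eq_dec i (S N)) as [->|]; [|apply HS; [lia|assumption]].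
  apply rootpoly_sign_below.
  + intros r Hr; destruct (HR r Hr) as [i0 [Hi0 [_ Hle]]].
    eapply Rlt_le_trans; [apply between_lt_max, Ht|].
    eapply Rle_trans; [|exact Hle].
    apply (Rmax_noninc n); [assumption|assumption|lia..].
  + apply between_neq in Ht.
    destruct (pow_m1_cases len) as [E|E]; rewrite E in *; lra.
- intros r Hr; destruct (HR r Hr) as [i0 [Hi0 H]]; exists i0; split; [lia|assumption].
- intros i Hi Hneg; destruct (Nat.eq_dec i (S N)) as [->|]; [lra|].
  destruct (HM i ltac:(lia) Hneg) as [i0 [Hi0 H]]; exists i0; split; [lia|assumption].
Qed.

(** The new node, the upper end of the new interval, lies strictly below all old nodes and below the
    interior of every old interval. Its factor is thus positive on the old intervals and negative on
    the new one. *)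
Lemma sign_changes_flip n N len tau x y :
  noninc n x -> noninc n y -> (S N <= n)%nat -> sign_changes N len tau x y ->
  (-1) ^ len * (x (S N) - y (S N)) < 0 ->
  sign_changes (S N) (S len) (snoc tau len (Rmax (x (S N)) (y (S N)))) x y.
Proof.
intros Hx Hy HN [[Hd HS] [HR HM]] Hs.
assert (Hxm : forall i j, (1 <= i)%nat -> (i <= j)%nat -> (j <= S N)%nat -> x j <= x i)
  by (intros; apply (noninc_le n); [assumption|lia..]).
assert (Hym : forall i j, (1 <= i)%nat -> (i <= j)%nat -> (j <= S N)%nat -> y j <= y i)
  by (intros; apply (noninc_le n); [assumption|lia..]).
set (r0 := Rmax (x (S N)) (y (S N))).
assert (Hr0 : forall r, (1 <= r <= len)%nat -> r0 < tau r).
{ intros r Hr; destruct (HR r Hr) as [i0 [Hi0 [Hpos Hle]]].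
  eapply Rlt_le_trans; [|exact Hle].
  assert (A1 := Hxm i0 (S N) ltac:(lia) ltac:(lia) ltac:(lia)).
  assert (A2 := Hym i0 (S N) ltac:(lia) ltac:(lia) ltac:(lia)).
  assert (B1 := Rmax_l (x i0) (y i0)); assert (B2 := Rmax_r (x i0) (y i0)).
  destruct (pow_m1_cases len) as [E|E]; rewrite E in *; unfold r0; apply Rmax_lub_lt; lra. }
assert (Hr0' : forall r, (1 <= r <= S len)%nat -> r0 <= snoc tau len r0 r).
{ intros r Hr; destruct (Nat.eq_dec r (S len)) as [->|]; [rewrite snoc_last; lra|].
  rewrite snoc_init by lia; apply Rlt_le, Hr0; lia. }
assert (Hpos : 0 < (-1) ^ S len * (x (S N) - y (S N))) by (simpl; lra).
split; [split; [apply decr_snoc; assumption|]|split].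
- intros i t Hi Ht; destruct (Nat.eq_dec i (S N)) as [->|Hne].
  + apply rootpoly_sign_below; [|assumption].
    intros r Hr; eapply Rlt_le_trans; [apply between_lt_max, Ht|apply Hr0', Hr].
  + rewrite rootpoly_snoc, <- Rmult_assoc.
    apply Rmult_lt_0_compat; [apply HS; [lia|assumption]|].
    enough (r0 < t) by lra.
    assert (A1 := Hxm i (S N) ltac:(lia) ltac:(lia) ltac:(lia)).
    assert (A2 := Hym i (S N) ltac:(lia) ltac:(lia) ltac:(lia)).
    (* If [i] already has the new sign, [HM] gives a later [i0] of the old sign; the interval of
       [i0] lies at or above [r0], and monotonicity then puts that of [i] above [r0]. *)
    destruct (Rlt_dec ((-1) ^ len * (x i - y i)) 0) as [Hneg|Hnn].
    * destruct (HM i ltac:(lia) Hneg) as [i0 [Hi0 Hp0]].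
      assert (B1 := Hxm i i0 ltac:(lia) ltac:(lia) ltac:(lia)).
      assert (B2 := Hym i i0 ltac:(lia) ltac:(lia) ltac:(lia)).
      assert (C1 := Hxm i0 (S N) ltac:(lia) ltac:(lia) ltac:(lia)).
      assert (C2 := Hym i0 (S N) ltac:(lia) ltac:(lia) ltac:(lia)).
      destruct Ht as [[? ?]|[? ?]];
      destruct (pow_m1_cases len) as [E|E]; rewrite E in *; unfold r0; apply Rmax_lub_lt; lra.
    * destruct Ht as [[? ?]|[? ?]];
      destruct (pow_m1_cases len) as [E|E]; rewrite E in *; unfold r0; apply Rmax_lub_lt; lra.
- intros r Hr; exists (S N); split; [lia|split; [assumption|apply Hr0', Hr]].
- intros i Hi Hneg; exists (S N); split; [|assumption].
  destruct (Nat.eq_dec i (S N)) as [->|]; [lra|lia].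
Qed.

Lemma separates_pad n len m tau x y :
  noninc n x -> noninc n y -> (len <= m)%nat -> separates n len tau x y ->
  exists tau', separates n m tau' x y.
Proof.
intros Hx Hy Hm H; induction Hm as [|m Hm [tau' [Hd HS]]]; [exists tau; assumption|].
(* Below all coordinates, so the extra factor is positive on every interval. For [m = 0] the value
   [tau' 0] is no node and can only lower [L]. *)
set (L := Rmin (Rmin (x n) (y n)) (tau' m) - 1).
assert (HL : L < Rmin (x n) (y n)) by (unfold L; assert (Hl := Rmin_l (Rmin (x n) (y n)) (tau' m)); lra).
assert (HLx : L < x n) by (eapply Rlt_le_trans; [exact HL|apply Rmin_l]).
assert (HLy : L < y n) by (eapply Rlt_le_trans; [exact HL|apply Rmin_r]).
exists (snoc tau' m L); split.
- apply decr_snoc; [assumption|].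
  intros i Hi; apply Rlt_le_trans with (tau' m).
  + unfold L; assert (Hl := Rmin_r (Rmin (x n) (y n)) (tau' m)); lra.
  + destruct (Nat.eq_dec i m) as [->|]; [lra|].
    apply Rlt_le, (decr_lt m); [assumption|lia..].
- intros i t Hi Ht; rewrite rootpoly_snoc, <- Rmult_assoc.
  apply Rmult_lt_0_compat; [apply HS; assumption|].
  assert (x n <= x i) by (apply (noninc_le n); [assumption|lia..]).
  assert (y n <= y i) by (apply (noninc_le n); [assumption|lia..]).
  destruct Ht as [[? ?]|[? ?]]; lra.
Qed.

(** * Sign changes along the blocks *)

Lemma block_index (ii : nat -> nat) m i :
  (1 <= m)%nat -> (ii 1 <= i)%nat -> (i < ii m)%nat ->
  exists q, (1 <= q)%nat /\ (q < m)%nat /\ (ii q <= i)%nat /\ (i < ii (S q))%nat.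
Proof.
intros Hm H1; induction Hm as [|m Hm IH]; intros Hi; [lia|].
destruct (le_lt_dec (ii m) i) as [Hle|Hlt].
- exists m; repeat split; [assumption|lia|assumption|assumption].
- destruct (IH Hlt) as [q Hq]; exists q; repeat split; try apply Hq; lia.
Qed.

Lemma block_mono (ii : nat -> nat) k p q :
  (forall j, (1 <= j)%nat -> (j < k)%nat -> (ii j <= ii (S j))%nat) ->
  (1 <= p)%nat -> (p <= q)%nat -> (q <= k)%nat -> (ii p <= ii q)%nat.
Proof.
intros H Hp Hpq; induction Hpq as [|q Hpq IH]; intros Hq; [lia|].
apply Nat.le_trans with (ii q); [apply IH; lia|apply H; lia].
Qed.

(** An odd block has at most one coordinate, so it costs at most one sign change. On an even block
    [x] is constant and [y] nonincreasing, so [x - y] stays positive once it is; the clause on even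
    [q] carries this through the induction. The clause for [N = O] serves coordinate 1, which has no
    predecessor. *)
Lemma sign_changes_blocks k n (ii : nat -> nat) x y :
  noninc n x -> noninc n y -> ii 1%nat = 1%nat -> ii k = S n -> (1 <= k)%nat ->
  (forall j, (1 <= j)%nat -> (j < k)%nat -> (ii j <= ii (S j))%nat) ->
  (forall j m, (1 <= j)%nat -> (j < k)%nat ->
     (ii j <= m)%nat -> (m < ii (S j))%nat -> x m = x (ii j)) ->
  (forall j, (1 <= j)%nat -> (2 * j <= k)%nat ->
     ii (2 * j)%nat = ii (2 * j - 1)%nat \/ ii (2 * j)%nat = S (ii (2 * j - 1)%nat)) ->
  forall N, (N <= n)%nat -> exists len tau, sign_changes N len tau x y /\
    (N = O -> len = O) /\
    forall q, (1 <= q)%nat -> (q < k)%nat -> (ii q <= N)%nat -> (N < ii (S q))%nat ->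
      (len <= q)%nat /\ (Nat.Even q -> len = q -> 0 < x N - y N).
Proof.
intros Hx Hy Hi1 Hik Hk Hmon Hblk Hone N; induction N as [|N IH]; intros HN.
- exists O, (fun _ => 0); split; [|split; [reflexivity|]].
  + split; [split|split]; [intros i ? ?| intros i t ?|intros r ?|intros i ?]; lia.
  + intros q H1 Hq Hle _.
    assert (ii 1 <= ii q)%nat by (apply (block_mono ii k); [assumption|lia..]); lia.
- destruct (IH ltac:(lia)) as [len [tau [Hsc [H0 Hq]]]].
  (* Either there is room for one more flip, or the block is even and a used-up budget forces a
     positive difference, which rules a flip out. *)
  assert (Hlen : forall q, (1 <= q)%nat -> (q < k)%nat -> (ii q <= S N)%nat -> (S N < ii (S q))%nat ->
    (len < q)%nat \/ (Nat.Even q /\ (len <= q)%nat /\ (len = q -> 0 < x (S N) - y (S N)))).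
  { intros q H1 Hqk Hlo Hhi.
    destruct (Nat.eq_dec N O) as [->|HN0]; [rewrite H0 by reflexivity; left; lia|].
    destruct (block_index ii k N ltac:(lia) ltac:(lia) ltac:(lia)) as [q' [H1' [Hq'k [Hlo' Hhi']]]].
    assert (Hc := Hq q' H1' Hq'k Hlo' Hhi'); destruct Hc as [Hc1 Hc2].
    destruct (le_lt_dec q q') as [Hle|Hlt]; [|left; lia].
    destruct (Nat.eq_dec q q') as [<-|Hne].
    - destruct (Nat.Even_or_Odd q) as [Hev|[j Hj]].
      + right; split; [assumption|split; [assumption|]].
        intros E; assert (Hd := Hc2 Hev E).
        assert (x N = x (ii q)) by (apply Hblk; assumption).
        assert (x (S N) = x (ii q)) by (apply Hblk; assumption).
        assert (y (S N) <= y N) by (apply Hy; lia).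
        lra.
      (* An odd block cannot contain both [N] and [S N]. *)
      + assert (Ho := Hone (S j) ltac:(lia) ltac:(lia)).
        replace (2 * S j)%nat with (S q) in Ho by lia; simpl minus in Ho.
        rewrite Nat.sub_0_r in Ho; lia.
    - assert (ii (S q) <= ii q')%nat by (apply (block_mono ii k); [assumption|lia..]); lia. }
  destruct (Rlt_dec ((-1) ^ len * (x (S N) - y (S N))) 0) as [Hneg|Hnn].
  + exists (S len), (snoc tau len (Rmax (x (S N)) (y (S N)))); split;
      [apply (sign_changes_flip n); assumption|split; [discriminate|]].
    intros q H1 Hqk Hlo Hhi; destruct (Hlen q H1 Hqk Hlo Hhi) as [Hlt|[Hev [Hle Hd]]].
    * split; [lia|intros Hev E].
      assert (Hp := pow_m1_even q Hev); rewrite <- E in Hp; simpl in Hp.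
      destruct (pow_m1_cases len) as [E'|E']; rewrite E' in *; lra.
    * assert (len <> q).
      { intros E; specialize (Hd E); rewrite E, pow_m1_even in Hneg by assumption; lra. }
      split; [lia|intros _ E].
      assert (Hp := pow_m1_even q Hev); rewrite <- E in Hp; simpl in Hp.
      destruct (pow_m1_cases len) as [E'|E']; rewrite E' in *; lra.
  + exists len, tau; split; [apply (sign_changes_keep n); [assumption..|lra]|split; [discriminate|]].
    intros q H1 Hqk Hlo Hhi; destruct (Hlen q H1 Hqk Hlo Hhi) as [Hlt|[Hev [Hle Hd]]];
      [split; [lia|intros; lia]|split; [assumption|intros _; assumption]].
Qed.

Lemma block_cond_separates k n x y :
  (2 <= k)%nat -> (1 <= n)%nat -> noninc n x -> noninc n y -> block_cond k n x ->
  exists tau, separates n (k - 1) tau x y.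
Proof.
intros Hk Hn Hx Hy [ii [H1 [Hend [Hmon [Hblk Hone]]]]].
destruct (sign_changes_blocks k n ii x y Hx Hy H1 Hend ltac:(lia) Hmon Hblk Hone n (le_n n))
  as [len [tau [[Hs _] [_ Hq]]]].
destruct (block_index ii k n ltac:(lia) ltac:(lia) ltac:(lia)) as [q [Hq1 [Hqk [Hlo Hhi]]]].
destruct (Hq q Hq1 Hqk Hlo Hhi) as [Hlen _].
apply (separates_pad n len _ tau); [assumption|assumption|lia|assumption].
Qed.

(** * Majorization *)

Lemma k_convex_polynomial_support k z f :
  (1 <= k)%nat -> k_convex k f -> decr (k - 1) z -> exists c h',
    (forall t, derivable_pt_lim (fun s => f s - peval k c s) t (h' t)) /\
    forall t, 0 <= h' t * rootpoly (k - 1) z t.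
Proof.
intros Hk [F [<- [HF Hpos]]] Hz.
destruct (interpolation_error_sign (k - 1) z (fun j => F (S j))) as [c Hc].
- intros j t Hj; apply HF; lia.
- intros t; replace (S (k - 1)) with k by lia; apply Hpos.
- assumption.
(* Antiderivative of the interpolant of f'. The constant term [c' 0] is a division by zero, an
   arbitrary real that [dcoef] never reads. *)
- set (c' := fun j => c (pred j) / INR j).
  exists c', (fun t => F 1%nat t - peval (k - 1) c t); split; [|assumption].
  intros t; apply (derivable_pt_lim_minus (F O)); [apply HF; lia|].
  replace k with (S (k - 1)) at 1 by lia.
  rewrite (peval_ext _ c (dcoef c')); [apply peval_deriv|].
  intros j _; unfold dcoef, c'; simpl pred; field; apply not_0_INR; lia.
Qed.

Lemma separates_majk k n s x y tau :
  (1 <= k)%nat -> inS k n s x -> inS k n s y -> separates n (k - 1) tau x y -> majk k n x y.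
Proof.
intros Hk [_ Hsx] [_ Hsy] [Hd Hsep] f Hf; apply Rle_ge.
destruct (k_convex_polynomial_support k tau f Hk Hf Hd) as [c [h' [Hder Hsgn]]].
set (h := fun t => f t - peval k c t) in *.
assert (Hh : sumR n (fun i => h (y i)) <= sumR n (fun i => h (x i))).
{ apply sumR_le; intros i Hi.
  destruct (Rtotal_order (x i) (y i)) as [Hlt|[E|Hgt]]; [|rewrite E; lra|].
  - destruct (MVT_cor2 h h' _ _ Hlt) as [r [Hr Hin]]; [intros; apply Hder|].
    assert (Hp := Hsep i r Hi (or_introl Hin)); specialize (Hsgn r).
    assert (rootpoly (k - 1) tau r < 0) by nra.
    assert (h' r <= 0) by nra. nra.
  - destruct (MVT_cor2 h h' _ _ Hgt) as [r [Hr Hin]]; [intros; apply Hder|].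
    assert (Hp := Hsep i r Hi (or_intror Hin)); specialize (Hsgn r).
    assert (0 < rootpoly (k - 1) tau r) by nra.
    assert (0 <= h' r) by nra. nra. }
assert (Hsplit : forall z, sumR n (fun i => f (z i)) =
  sumR n (fun i => h (z i)) + peval k (fun j => c j * psum n j z) 1).
{ intros z; rewrite <- sumR_peval, <- sumR_plus; apply sumR_ext; intros; unfold h; ring. }
rewrite !Hsplit.
rewrite (peval_ext k (fun j => c j * psum n j x) (fun j => c j * psum n j y)); [lra|].
(* Order 0 is not among the constraints of [inS], but that power sum is [n] for every point. *)
intros j Hj; destruct j as [|j]; [reflexivity|].
rewrite Hsx, Hsy by lia; reflexivity.
Qed.

Lemma block_cond_majk k n s x y :
  (2 <= k)%nat -> (1 <= n)%nat -> inS k n s x -> inS k n s y -> block_cond k n x -> majk k n x y.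
Proof.
intros Hk Hn Hx Hy Hb.
destruct (block_cond_separates k n x y Hk Hn (proj1 Hx) (proj1 Hy) Hb) as [tau Htau].
apply (separates_majk k n s x y tau); [lia|assumption..].
Qed.

(** The power t^k in coefficient form, so that [tower_peval] supplies its derivatives; the k-th is a
    positive constant. *)
Lemma k_convex_pow k : k_convex k (peval (S k) (fun j => if Nat.eq_dec j k then 1 else 0)).
Proof.
set (c := fun j => if Nat.eq_dec j k then 1 else 0).
exists (fun i => peval (S k - i) (Nat.iter i dcoef c)); split; [reflexivity|split].
- intros m t Hm; apply (tower_peval (S k) c); lia.
- intros t; replace (S k - k)%nat with 1%nat by lia; simpl peval.
  destruct (iter_dcoef k 0) as [a [Ha Hca]]; rewrite Hca, Nat.add_0_r.
  unfold c; destruct (Nat.eq_dec k k); [lra|lia].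
Qed.

Lemma majk_psum k n x y : majk k n x y -> psum n k y <= psum n k x.
Proof.
intros H; specialize (H _ (k_convex_pow k)).
assert (E : forall t, peval (S k) (fun j => if Nat.eq_dec j k then 1 else 0) t = t ^ k).
{ intros t; rewrite peval_S; destruct (Nat.eq_dec k k); [|lia].
  rewrite (peval_ext k _ (fun _ => 0)), peval_0; [ring|].
  intros j Hj; destruct (Nat.eq_dec j k); [lia|reflexivity]. }
rewrite !(sumR_ext n (fun i => peval _ _ _) _ (fun i _ => E _)) in H.
unfold psum; lra.
Qed.

(** * The greedy block decomposition *)

(** An unsuccessful search returns [m + fuel]; [greedy] chooses the fuel so that this is [S n], the
    end marker of the last block. *)
Fixpoint first_below (x : nat -> R) (v : R) (fuel m : nat) : nat :=
  match fuel with
  | O => m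
  | S f => if Rlt_dec (x m) v then m else first_below x v f (S m)
  end.

Lemma first_below_spec x v fuel m :
  (m <= first_below x v fuel m <= m + fuel)%nat /\
  (forall i, (m <= i)%nat -> (i < first_below x v fuel m)%nat -> v <= x i) /\
  ((first_below x v fuel m < m + fuel)%nat -> x (first_below x v fuel m) < v).
Proof.
revert m; induction fuel as [|fuel IH]; intros m; simpl.
- repeat split; try lia; intros; lia.
- destruct (Rlt_dec (x m) v) as [Hlt|Hge].
  + repeat split; [lia|lia|intros; lia|intros; assumption].
  + destruct (IH (S m)) as [H1 [H2 H3]].
    split; [lia|split; [|intros; apply H3; lia]].
    intros i Hm Hi; destruct (Nat.eq_dec i m) as [->|]; [lra|apply H2; lia].
Qed.

(* greedy x n j is the start of block j + 1, i.e. i_{j+1} in the indexing of block_cond. *)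
Fixpoint greedy (x : nat -> R) (n j : nat) : nat :=
  match j with
  | O => 1%nat
  | S j' => let g := greedy x n j' in
            if Nat.even j' then Nat.min (S g) (S n)
            else first_below x (x g) (S n - g) g
  end.

Lemma greedy_bounds x n j : (1 <= greedy x n j <= S n)%nat.
Proof.
induction j as [|j IH]; cbn [greedy]; [lia|].
destruct (Nat.even j); [lia|].
destruct (first_below_spec x (x (greedy x n j)) (S n - greedy x n j) (greedy x n j)) as [H _]; lia.
Qed.

Lemma greedy_even x n j :
  Nat.Even j -> greedy x n (S j) = Nat.min (S (greedy x n j)) (S n).
Proof. intros H; apply Nat.even_spec in H; cbn [greedy]; rewrite H; reflexivity. Qed.

Lemma greedy_odd x n j :
  Nat.Odd j -> 
  (greedy x n j <= greedy x n (S j) <= S n)%nat /\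
  (forall i, (greedy x n j <= i)%nat -> (i < greedy x n (S j))%nat -> x (greedy x n j) <= x i) /\
  ((greedy x n (S j) <= n)%nat -> x (greedy x n (S j)) < x (greedy x n j)) /\
  ((greedy x n j <= n)%nat -> (greedy x n j < greedy x n (S j))%nat).
Proof.
intros H; assert (E : Nat.even j = false)
  by (rewrite <- Nat.negb_odd; apply Nat.odd_spec in H; rewrite H; reflexivity).
cbn [greedy]; rewrite E.
assert (Hb := greedy_bounds x n j); set (g := greedy x n j) in *.
destruct (first_below_spec x (x g) (S n - g) g) as [H1 [H2 H3]].
set (r := first_below _ _ _ _) in *.
split; [lia|split; [assumption|split; [intros; apply H3; lia|]]].
intros Hg; destruct (Nat.eq_dec r g) as [E'|]; [|lia].
rewrite E' in H3; specialize (H3 ltac:(lia)); lra.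
Qed.

Lemma greedy_mono x n j : (greedy x n j <= greedy x n (S j))%nat.
Proof.
destruct (Nat.Even_or_Odd j) as [H|H].
- rewrite greedy_even by assumption; assert (Hb := greedy_bounds x n j); lia.
- apply (greedy_odd x n j H).
Qed.

Lemma greedy_block_cond k n x :
  (1 <= k)%nat -> noninc n x -> greedy x n (k - 1) = S n -> block_cond k n x.
Proof.
intros Hk Hx Hend; exists (fun j => greedy x n (pred j)).
split; [reflexivity|split; [rewrite <- Hend; f_equal; lia|split; [|split]]].
- intros j H1 _; destruct j as [|j]; [lia|]; apply greedy_mono.
- intros j m H1 _ Hlo Hhi; destruct j as [|j]; [lia|]; simpl pred in *.
  assert (Hb := greedy_bounds x n (S j)).
  destruct (Nat.Even_or_Odd j) as [H|H].
  + rewrite greedy_even in Hhi by assumption; f_equal; lia.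
  + destruct (greedy_odd x n j H) as [_ [H2 _]].
    apply Rle_antisym; [|apply H2; assumption].
    apply (noninc_le n); [assumption|apply greedy_bounds|assumption|lia].
- intros j H1 _; destruct j as [|j]; [lia|].
  replace (pred (2 * S j)) with (S (2 * j)) by lia.
  replace (pred (2 * S j - 1)) with (2 * j)%nat by lia.
  rewrite greedy_even by (exists j; reflexivity).
  assert (Hb := greedy_bounds x n (2 * j)); lia.
Qed.

(* The coordinates a_1 < a_2 < ... can be moved slightly up (odd positions) or down (even
   positions) without leaving the cone of nonincreasing vectors. *)
Definition alternating (k n : nat) (x : nat -> R) (a : nat -> nat) : Prop :=
  (forall j, (1 <= j <= k)%nat -> (1 <= a j <= n)%nat) /\
  (forall j, (1 <= j)%nat -> (j < k)%nat -> (a j < a (S j))%nat) /\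
  (forall j, (1 <= j <= k)%nat -> Nat.Odd j -> a j = 1%nat \/ x (a j) < x (pred (a j))) /\
  (forall j, (1 <= j <= k)%nat -> Nat.Even j -> a j = n \/ x (S (a j)) < x (a j)).

(** Take the first coordinate of each odd block, which is strictly below its predecessor unless it
    is coordinate 1, and the last coordinate of each even block, which is strictly above its
    successor unless it is coordinate [n]. *)
Lemma greedy_alternating k n x :
  noninc n x -> (greedy x n (k - 1) <= n)%nat -> exists a, alternating k n x a.
Proof.
intros Hx Hend.
assert (Hle : forall j, (S j <= k)%nat -> (greedy x n j <= n)%nat).
{ intros j Hj; replace (k - 1)%nat with (j + (k - 1 - j))%nat in Hend by lia.
  induction (k - 1 - j)%nat as [|d IH]; [rewrite Nat.add_0_r in Hend; assumption|].
  apply IH; rewrite Nat.add_succ_r in Hend.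
  assert (H := greedy_mono x n (j + d)); lia. }
set (a := fun j => if Nat.even (pred j) then greedy x n (pred j) else (greedy x n j - 1)%nat).
assert (Ha1 : forall j, Nat.Even j -> a (S j) = greedy x n j).
{ intros j Hj; unfold a; simpl pred; apply Nat.even_spec in Hj; rewrite Hj; reflexivity. }
assert (Ha2 : forall j, Nat.Odd j -> a (S j) = (greedy x n (S j) - 1)%nat).
{ intros j Hj; unfold a; simpl pred; rewrite <- Nat.negb_odd.
  apply Nat.odd_spec in Hj; rewrite Hj; reflexivity. }
exists a; split; [|split; [|split]].
- intros [|j] Hj; [lia|].
  assert (Hb := greedy_bounds x n j); assert (Hg := Hle j ltac:(lia)).
  destruct (Nat.Even_or_Odd j) as [H|H]; [rewrite Ha1 by assumption; lia|].
  rewrite Ha2 by assumption.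
  destruct (greedy_odd x n j H) as [H1 [_ [_ H4]]]; specialize (H4 Hg); lia.
- intros [|j] H1 Hj; [lia|].
  assert (Hg := Hle j ltac:(lia)); assert (Hg' := Hle (S j) ltac:(lia)).
  assert (Hb := greedy_bounds x n (S j)).
  destruct (Nat.Even_or_Odd j) as [H|H].
  + rewrite Ha1, Ha2 by (assumption || (apply Nat.Odd_succ; assumption)).
    destruct (greedy_odd x n (S j)) as [_ [_ [_ H4]]]; [apply Nat.Odd_succ; assumption|].
    specialize (H4 Hg'); rewrite greedy_even in * by assumption; lia.
  + rewrite Ha2, Ha1 by (assumption || (apply Nat.Even_succ; assumption)); lia.
- intros [|j] Hj Hodd; [lia|]; apply Nat.Odd_succ in Hodd; rewrite Ha1 by assumption.
  destruct j as [|j]; [left; reflexivity|right].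
  apply Nat.Even_succ in Hodd.
  destruct (greedy_odd x n j Hodd) as [H1 [H2 [H3 H4]]].
  specialize (H4 (Hle j ltac:(lia))); specialize (H3 (Hle (S j) ltac:(lia))).
  eapply Rlt_le_trans; [exact H3|apply H2; lia].
- intros [|j] Hj Hev; [lia|]; apply Nat.Even_succ in Hev; rewrite Ha2 by assumption.
  destruct (greedy_odd x n j Hev) as [H1 [H2 [H3 H4]]].
  specialize (H4 (Hle j ltac:(lia))).
  destruct (Nat.eq_dec (greedy x n (S j)) (S n)) as [E|]; [left; lia|right].
  replace (S (greedy x n (S j) - 1)) with (greedy x n (S j)) by lia.
  eapply Rlt_le_trans; [apply H3; lia|apply H2; lia].
Qed.

(** * Perturbing a point that fails the block condition *)

Fixpoint replace_coords (x : nat -> R) (a : nat -> nat) (w : nat -> R) (m : nat) : nat -> R :=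
  match m with
  | O => x
  | S m' => fun i => if Nat.eq_dec i (a (S m')) then w (S m') else replace_coords x a w m' i
  end.

Lemma replace_coords_ind (P : nat -> R -> Prop) x a w m :
  (forall i, P i (x i)) -> (forall j, (1 <= j <= m)%nat -> P (a j) (w j)) ->
  forall i, P i (replace_coords x a w m i).
Proof.
intros Hx; induction m as [|m IH]; intros Hw i; simpl; [apply Hx|].
destruct (Nat.eq_dec i (a (S m))) as [->|]; [apply Hw; lia|].
apply IH; intros; apply Hw; lia.
Qed.

Lemma replace_coords_out x a w m i :
  (forall j, (1 <= j <= m)%nat -> i <> a j) -> replace_coords x a w m i = x i.
Proof.
induction m as [|m IH]; intros H; simpl; [reflexivity|].
destruct (Nat.eq_dec i (a (S m))) as [E|]; [destruct (H (S m)); [lia|assumption]|].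
apply IH; intros; apply H; lia.
Qed.

Lemma psum_replace1 n p z b v :
  (1 <= b <= n)%nat ->
  psum n p (fun i => if Nat.eq_dec i b then v else z i) = psum n p z - z b ^ p + v ^ p.
Proof.
unfold psum; induction n as [|n IH]; intros Hb; [lia|].
rewrite !sumR_S; destruct (Nat.eq_dec (S n) b) as [<-|Hne].
- rewrite (sumR_ext n _ (fun i => z i ^ p)); [ring|].
  intros i Hi; destruct (Nat.eq_dec i (S n)); [lia|reflexivity].
- rewrite IH by lia; ring.
Qed.

Lemma psum_replace_coords n p x a w m :
  (forall j, (1 <= j <= m)%nat -> (1 <= a j <= n)%nat) ->
  (forall j, (1 <= j)%nat -> (j < m)%nat -> (a j < a (S j))%nat) ->
  psum n p (replace_coords x a w m) = psum n p x + psum m p w - psum m p (fun j => x (a j)).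
Proof.
induction m as [|m IH]; intros Hb Hinc; simpl replace_coords; [unfold psum; simpl; ring|].
rewrite psum_replace1 by (apply Hb; lia).
rewrite IH by (intros; (apply Hb || apply Hinc); lia).
rewrite replace_coords_out; [unfold psum; rewrite !sumR_S; ring|].
intros j Hj E.
assert (H : forall q, (j <= q)%nat -> (q <= m)%nat -> (a j < a (S q))%nat).
{ intros q Hq; induction Hq as [|q Hq IHq]; intros Hqm; [apply Hinc; lia|].
  apply Nat.lt_trans with (a (S q)); [apply IHq; lia|apply Hinc; lia]. }
specialize (H m ltac:(lia) (le_n m)); lia.
Qed.

Lemma Rabs_le_bounds a b : Rabs a <= b -> - b <= a <= b.
Proof.
intros H; assert (H1 := Rle_abs a); assert (H2 := Rle_abs (- a)).
rewrite Rabs_Ropp in H2; lra.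
Qed.

Lemma gap_lower_bound n x : exists e, 0 < e /\
  forall i, (1 <= i <= n)%nat -> x (S i) < x i -> x (S i) + e < x i.
Proof.
destruct (finite_pos_lower_bound
  (fun i => if Rlt_dec (x (S i)) (x i) then x i - x (S i) else 1) n) as [e [He H]].
- intros i _; destruct (Rlt_dec (x (S i)) (x i)); lra.
- exists e; split; [assumption|]; intros i Hi Hlt.
  specialize (H i Hi); cbv beta in H; destruct (Rlt_dec (x (S i)) (x i)); lra.
Qed.

(* Raising the level of rootpoly from 0 to a small e > 0 keeps all elementary symmetric
   functions of the roots except the last one; it pushes the roots u_1, u_3, ... up and
   u_2, u_4, ... down, splitting the double roots u_(2j-1) = u_(2j). *)
Lemma shifted_roots k u d :
  (1 <= k)%nat -> 0 < d -> noninc k u ->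
  (forall j, (1 <= j)%nat -> (j < k)%nat -> Nat.Even j -> u (S j) + 2 * d < u j) ->
  exists w e, 0 < e /\
    (forall j, (1 <= j <= k)%nat -> Rabs (w j - u j) <= d /\
       (Nat.Odd j -> u j < w j) /\ (Nat.Even j -> w j < u j)) /\
    (forall j, (1 <= j)%nat -> (j < k)%nat -> psum k j w = psum k j u) /\
    psum k k w = psum k k u + INR k * e.
Proof.
intros Hk Hd Hu Hgap.
assert (Hmon : forall i j, (1 <= i)%nat -> (i <= j)%nat -> (j <= k)%nat -> u j <= u i)
  by (intros; apply (noninc_le k); assumption).
(* In this claim and the next an even number of roots exceeds the test point: j-1 for odd j, j for
   even j. The gaps after even indices make the count exact. *)
assert (Hodd : forall j, (1 <= j <= k)%nat -> Nat.Odd j -> 0 < rootpoly k u (u j + d)).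
{ intros j Hj Ho; destruct j as [|j]; [lia|]; apply Nat.Odd_succ in Ho.
  rewrite <- (Rmult_1_l (rootpoly _ _ _)), <- (pow_m1_even j Ho).
  apply rootpoly_sign; [lia| |].
  - intros i Hi.
    assert (u (S j) + 2 * d < u j) by (apply Hgap; [lia|lia|assumption]).
    assert (u j <= u i) by (apply Hmon; lia). lra.
  - intros i Hi; assert (u i <= u (S j)) by (apply Hmon; lia); lra. }
assert (Heven : forall j, (1 <= j <= k)%nat -> Nat.Even j -> 0 < rootpoly k u (u j - d)).
{ intros j Hj He.
  rewrite <- (Rmult_1_l (rootpoly _ _ _)), <- (pow_m1_even j He).
  apply rootpoly_sign; [lia| |].
  - intros i Hi; assert (u j <= u i) by (apply Hmon; lia); lra.
  - intros i Hi.
    assert (u (S j) + 2 * d < u j) by (apply Hgap; [lia|lia|assumption]).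
    assert (u i <= u (S j)) by (apply Hmon; lia). lra. }
(* The level [e] lies below all these [k] values while [rootpoly] is 0 at [u j], so it is attained
   between [u j] and each test point. *)
destruct (finite_pos_lower_bound
  (fun j => rootpoly k u (if Nat.even j then u j - d else u j + d)) k) as [e [He Hmin]].
{ intros j Hj; destruct (Nat.even j) eqn:E.
  - apply Heven; [assumption|apply Nat.even_spec; assumption].
  - apply Hodd; [assumption|apply Nat.odd_spec; rewrite <- Nat.negb_even, E; reflexivity]. }
assert (Hcont : continuity (fun t => rootpoly k u t - e)).
{ apply continuity_minus; [|apply continuity_const; intros ? ?; reflexivity].
  intros t; apply (continuity_pt_locally_ext (peval (S k) (fun j => esym k u (k - j))) _ 1 t);
    [lra|intros; symmetry; apply rootpoly_peval|apply peval_continuity]. }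
destruct (finite_choice (fun j r => rootpoly k u r = e /\ Rabs (r - u j) <= d /\
   (Nat.Odd j -> u j < r) /\ (Nat.Even j -> r < u j)) k) as [w Hw].
{ intros j Hj; specialize (Hmin j Hj); cbv beta in Hmin.
  assert (Hr := rootpoly_root k u j Hj).
  destruct (Nat.even j) eqn:E.
  - destruct (IVT_cor (fun t => rootpoly k u t - e) (u j - d) (u j) Hcont) as [r [Hin H0]];
      [lra|rewrite Hr; nra|].
    assert (r <> u j) by (intros ->; lra).
    exists r; split; [lra|split; [apply Rabs_le; lra|split; [|intros; lra]]].
    intros Ho; apply Nat.odd_spec in Ho; rewrite <- Nat.negb_even, E in Ho; discriminate.
  - destruct (IVT_cor (fun t => rootpoly k u t - e) (u j) (u j + d) Hcont) as [r [Hin H0]];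
      [lra|rewrite Hr; nra|].
    assert (r <> u j) by (intros ->; lra).
    exists r; split; [lra|split; [apply Rabs_le; lra|split; [intros; lra|]]].
    intros Ho; apply Nat.even_spec in Ho; rewrite E in Ho; discriminate. }
assert (Hdec : decr k w).
{ intros j H1 Hj.
  destruct (Hw j ltac:(lia)) as [_ [Ha [Ho _]]].
  destruct (Hw (S j) ltac:(lia)) as [_ [Ha' [_ He']]].
  apply Rabs_le_bounds in Ha, Ha'.
  destruct (Nat.Even_or_Odd j) as [H|H].
  - assert (H' := Hgap j H1 Hj H); lra.
  - specialize (Ho H); specialize (He' (proj2 (Nat.Even_succ j) H)).
    assert (u (S j) <= u j) by (apply Hmon; lia); lra. }
destruct (esym_of_shifted_rootpoly k u w e Hk Hdec) as [E1 E2]; [intros; apply Hw; assumption|].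
destruct (newton_perturb k u w e Hk E1 E2) as [P1 P2].
exists w, e; repeat split; try assumption; apply Hw; assumption.
Qed.

Lemma distn_lt n x y d eps :
  (forall i, Rabs (y i - x i) <= d) -> INR (S n) * d < eps -> distn n x y < eps.
Proof.
intros Hd Heps.
assert (Hd0 : 0 <= d) by (eapply Rle_trans; [apply Rabs_pos|apply (Hd O)]).
assert (Hn := pos_INR n); rewrite S_INR in Heps.
apply Rle_lt_trans with ((INR n + 1) * d); [|assumption].
unfold distn; rewrite <- (sqrt_Rsqr ((INR n + 1) * d)) by nra.
apply sqrt_le_1_alt.
apply Rle_trans with (INR n * (d * d)).
- rewrite <- sumR_const; apply sumR_le; intros i _.
  specialize (Hd i); rewrite <- (pow2_abs (y i - x i)); assert (Hp := Rabs_pos (y i - x i)); nra.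
- unfold Rsqr; nra.
Qed.

Lemma alternating_not_local_max k n s x a :
  (1 <= k)%nat -> inS k n s x -> alternating k n x a -> ~ local_max_on_S k n s x.
Proof.
intros Hk [Hx Hs] [Hb [Hinc [Hup Hdn]]] [eps [Heps Hmax]].
destruct (gap_lower_bound n x) as [g [Hg Hgap]].
assert (Hn0 : 0 < INR (S n)) by (apply lt_0_INR; lia).
assert (Hq : 0 < eps / INR (S n)) by (apply Rdiv_lt_0_compat; assumption).
(* Two neighbours moving by at most [d] each cannot cross a gap above [g >= 2 * d], and
   [INR (S n) * d < eps] bounds the distance. *)
set (d := Rmin g (eps / INR (S n)) / 2).
assert (Hd : 0 < d) by (assert (0 < Rmin g (eps / INR (S n))) by (apply Rmin_glb_lt; assumption);
  unfold d; lra).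
assert (Hdg : 2 * d <= g) by (assert (H := Rmin_l g (eps / INR (S n))); unfold d; lra).
assert (Hde : INR (S n) * d < eps).
{ assert (H : d < eps / INR (S n)) by (assert (H := Rmin_r g (eps / INR (S n))); unfold d in *; lra).
  apply (Rmult_lt_compat_l (INR (S n))) in H; [|assumption].
  replace (INR (S n) * (eps / INR (S n))) with eps in H by (field; lra); assumption. }
destruct (shifted_roots k (fun j => x (a j)) d Hk Hd) as [w [e [He [Hw [Hp1 Hp2]]]]].
{ intros j H1 Hj; assert (Ha := Hinc j H1 Hj).
  assert (Ha1 := Hb j ltac:(lia)); assert (Ha2 := Hb (S j) ltac:(lia)).
  apply (noninc_le n); [assumption|lia..]. }
{ intros j H1 Hj Hev; assert (Ha := Hinc j H1 Hj).
  assert (Ha1 := Hb j ltac:(lia)); assert (Ha2 := Hb (S j) ltac:(lia)).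
  destruct (Hdn j ltac:(lia) Hev) as [|Hlt]; [lia|].
  assert (Hg1 := Hgap (a j) ltac:(lia) Hlt).
  assert (x (a (S j)) <= x (S (a j))) by (apply (noninc_le n); [assumption|lia..]).
  lra. }
set (y := replace_coords x a w k).
assert (Hy : forall i, Rabs (y i - x i) <= d /\
  (x i < y i -> i = 1%nat \/ x i < x (pred i)) /\ (y i < x i -> i = n \/ x (S i) < x i)).
{ apply (replace_coords_ind (fun i v => Rabs (v - x i) <= d /\
    (x i < v -> i = 1%nat \/ x i < x (pred i)) /\ (v < x i -> i = n \/ x (S i) < x i))).
  - intros i; split; [rewrite Rminus_diag, Rabs_R0; lra|split; intros; lra].
  - intros j Hj; destruct (Hw j Hj) as [H1 [H2 H3]]; split; [assumption|].
    destruct (Nat.Even_or_Odd j) as [H|H].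
    + specialize (H3 H); split; intros; [lra|apply Hdn; assumption].
    + specialize (H2 H); split; intros; [apply Hup; assumption|lra]. }
assert (HyS : inS k n s y).
{ split.
  - intros i H1 Hi.
    destruct (Hy i) as [Ha [_ Hdi]]; destruct (Hy (S i)) as [Ha' [Hui _]].
    apply Rabs_le_bounds in Ha, Ha'; simpl pred in Hui.
    destruct (Rlt_dec (x (S i)) (x i)) as [Hlt|Hnlt].
    + assert (Hg1 := Hgap i ltac:(lia) Hlt); lra.
    (* In a tie the left coordinate cannot have moved down nor the right one up, so the order
       survives. *)
    + assert (Hle := Hx i H1 Hi).
      assert (~ y i < x i) by (intros Hc; destruct (Hdi Hc); [lia|lra]).
      assert (~ x (S i) < y (S i)) by (intros Hc; destruct (Hui Hc); [lia|lra]).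
      lra.
  - intros j H1 Hj; unfold y; rewrite psum_replace_coords by assumption.
    rewrite Hp1 by lia; rewrite Hs by assumption; ring. }
assert (Hfin := Hmax y HyS (distn_lt n x y d eps (fun i => proj1 (Hy i)) Hde)).
unfold y in Hfin; rewrite psum_replace_coords, Hp2 in Hfin by assumption.
assert (0 < INR k * e) by (apply Rmult_lt_0_compat; [apply lt_0_INR; lia|assumption]).
lra.
Qed.

Lemma local_max_block_cond k n s x :
  (1 <= k)%nat -> inS k n s x -> local_max_on_S k n s x -> block_cond k n x.
Proof.
intros Hk Hx Hmax.
assert (Hb := greedy_bounds x n (k - 1)).
destruct (Nat.eq_dec (greedy x n (k - 1)) (S n)) as [E|Hne].
- apply greedy_block_cond; [assumption|exact (proj1 Hx)|assumption].
- destruct (greedy_alternating k n x (proj1 Hx)) as [a Ha]; [lia|].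
  destruct (alternating_not_local_max k n s x a Hk Hx Ha Hmax).
Qed.

Theorem mainTheorem14 (k n : nat) (s : nat -> R) (x : nat -> R) :
  (3 <= k)%nat -> (k <= n)%nat -> inS k n s x ->
  (local_max_on_S k n s x <-> block_cond k n x) /\
  (block_cond k n x <-> (forall y, inS k n s y -> majk k n x y)).
Proof.
intros Hk Hn Hx.
assert (H12 : local_max_on_S k n s x -> block_cond k n x)
  by (apply local_max_block_cond; [lia|assumption]).
assert (H23 : block_cond k n x -> forall y, inS k n s y -> majk k n x y)
  by (intros Hb y Hy; apply (block_cond_majk k n s); [lia|lia|assumption..]).
assert (H31 : (forall y, inS k n s y -> majk k n x y) -> local_max_on_S k n s x).
(* The maximum is global, so any radius works. *)
{ intros H; exists 1; split; [lra|].
  intros y Hy _; apply majk_psum, H; assumption. }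
tauto.
Qed.
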